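(* Let $0<q_1<1$ and $0<q_2<1$, let $u:[0,\infty)\to[0,\infty)$ be a continuous function, let $\lambda\in\mathbb{R}$, and let $f,g,h\in C_\lambda$ be three synchronous functions on $[0,\infty)$ for which there are constants $\phi,\psi,\omega,\Phi,\Psi,\Omega\in\mathbb{R}$ with $$\psi\le f(x)\le\Psi,\qquad \phi\le g(x)\le\Phi,\qquad \omega\le h(x)\le\Omega\qquad\text{for all }x\in[0,\infty).$$ Then the following inequality holds for all $t>0$, all $\mu,\nu,\beta,\delta>0$ and all $\eta,\zeta\in\mathbb{C}$: $$ \begin{aligned} \Bigl|\, & I^{\eta,\mu,\beta}_{q_1}\{u(t)f(t)g(t)h(t)\}\,I^{\zeta,\nu,\delta}_{q_2}\{u(t)\}+I^{\eta,\mu,\beta}_{q_1}\{u(t)h(t)\}\,I^{\zeta,\nu,\delta}_{q_2}\{u(t)f(t)g(t)\}\\ &+I^{\eta,\mu,\beta}_{q_1}\{u(t)g(t)\}\,I^{\zeta,\nu,\delta}_{q_2}\{u(t)f(t)h(t)\}+I^{\eta,\mu,\beta}_{q_1}\{u(t)f(t)\}\,I^{\zeta,\nu,\delta}_{q_2}\{u(t)g(t)h(t)\}\\ &-I^{\eta,\mu,\beta}_{q_1}\{u(t)g(t)h(t)\}\,I^{\zeta,\nu,\delta}_{q_2}\{u(t)f(t)\}-I^{\eta,\mu,\beta}_{q_1}\{u(t)f(t)h(t)\}\,I^{\zeta,\nu,\delta}_{q_2}\{u(t)g(t)\}\\ &-I^{\eta,\mu,\beta}_{q_1}\{u(t)f(t)g(t)\}\,I^{\zeta,\nu,\delta}_{q_2}\{u(t)h(t)\}-I^{\eta,\mu,\beta}_{q_1}\{u(t)\}\,I^{\zeta,\nu,\delta}_{q_2}\{u(t)f(t)g(t)h(t)\}\Bigr|\\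 &\le I^{\eta,\mu,\beta}_{q_1}\{u(t)\}\,I^{\zeta,\nu,\delta}_{q_2}\{u(t)\}\,(\Psi-\psi)(\Phi-\phi)(\Omega-\omega). \end{aligned} $$
   Context: Two real functions $f,g$ are synchronous on an interval $I$ if $(f(x)-f(y))(g(x)-g(y))\ge 0$ for all $x,y\in I$; three functions are called synchronous if any two of them are. A real-valued function $f(t)$ ($t>0$) belongs to $C_\lambda$ ($\lambda\in\mathbb{R}$) if there is a real number $p>\lambda$ such that $f(t)=t^p\varphi(t)$ with $\varphi\in C(0,\infty)$. For $0<q<1$ the $q$-shifted factorial is $(a;q)_0=1$ and $(a;q)_k=\prod_{j=0}^{k-1}(1-aq^j)$ for $k\ge1$. For $\Re(\beta),\Re(\mu)>0$ and $\eta\in\mathbb{C}$, the generalized Erdélyi-Kober fractional $q$-integral operator is $$I^{\eta,\mu,\beta}_q\{f(t)\}=\beta\,(1-q^{1/\beta})(1-q)^{\mu-1}\sum_{k=0}^\infty\frac{(q^\mu;q)_k}{(q;q)_k}\,q^{k(\eta+1)}f\bigl(tq^{k/\beta}\bigr),\qquad t>0.$$ The notation $I^{\eta,\mu,\beta}_q\{F(t)\}$ means the operator applied to the function $F$ and evaluated at $t$.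
   Formalization: Instead of all complex η, ζ, only those for which q_1^η and q_2^ζ are positive reals (e.g. all real η, ζ) are covered, since the inequality fails otherwise; the series defining the two operators applied to u are assumed to converge. *)

(* Defs.v *)
From HB Require Import structures.
From mathcomp Require Import all_boot all_order all_algebra.
From mathcomp Require Import all_classical all_reals all_analysis.
From mathcomp Require Import complex.

Set Implicit Arguments.
Unset Strict Implicit.
Unset Printing Implicit Defensive.

Import Order.TTheory GRing.Theory Num.Theory.
Import numFieldNormedType.Exports.

Local Open Scope classical_set_scope.
Local Open Scope complex_scope.
Local Open Scope ring_scope.

Definition synchronous (R : realType) (I : set R) (f g : R -> R) : Prop :=
  forall x y, I x -> I y -> 0 <= (f x - f y) * (g x - g y).

Definition synchronous3 (R : realType) (I : set R) (f g h : R -> R) : Prop :=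
  [/\ synchronous I f g, synchronous I f h & synchronous I g h].

Definition class_C (R : realType) (lambda : R) (f : R -> R) : Prop :=
  exists (p : R) (phi : R -> R),
    [/\ lambda < p,
        {within `]0, +oo[, continuous phi} &
        forall t, 0 < t -> f t = t `^ p * phi t].

Definition qpochhammer (R : pzRingType) (a q : R) (k : nat) : R :=
  \prod_(j < k) (1 - a * q ^+ j).

(* q ^ z = exp (z ln q), meaningful for 0 < q only *)
Definition cpow (R : realType) (q : R) (z : R[i]) : R[i] :=
  (q `^ complex.Re z)%:C
  * (cos (complex.Im z * ln q) +i* sin (complex.Im z * ln q)).

Definition EK_term (R : realType) (q : R) (eta : R[i]) (mu beta : R)
    (F : R -> R) (t : R) (k : nat) : R[i] :=
  (qpochhammer (q `^ mu) q k / qpochhammer q q k)%:C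
  * cpow q (k%:R * (eta + 1))
  * (F (t * q `^ (k%:R / beta)))%:C.

(* R[i]^o is R[i] seen as a normed space, with the topology of the modulus. *)
Definition EK_cvg (R : realType) (q : R) (eta : R[i]) (mu beta : R)
    (F : R -> R) (t : R) : Prop :=
  cvgn (series (EK_term q eta mu beta F t : nat -> R[i]^o)).

(* The generalized Erdelyi-Kober fractional q-integral of F, evaluated at t;
   meaningful only when EK_cvg holds, as limn is total. *)
Definition EK (R : realType) (q : R) (eta : R[i]) (mu beta : R)
    (F : R -> R) (t : R) : R[i] :=
  (beta * (1 - q `^ beta^-1) * (1 - q) `^ (mu - 1))%:C
  * (limn (series (EK_term q eta mu beta F t : nat -> R[i]^o)) : R[i]).

(* On R[i], 0 < z means that z is a positive real, so a condition
   0 < cpow q eta is satisfied by every real eta. *)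
Lemma cpow_gt0_real (R : realType) (q x : R) :
  0 < q -> 0 < cpow q x%:C.
Proof.
move=> q0; rewrite /cpow /= mul0r cos0 sin0 -[1 +i* 0]/(1%:C) mulr1.
by rewrite ltcR powR_gt0.
Qed.

(* Main.v *)
Require Import Defs.
From HB Require Import structures.
From mathcomp Require Import all_boot all_order all_algebra.
From mathcomp Require Import all_classical all_reals all_analysis.
From mathcomp Require Import complex.
From mathcomp Require Import ring lra.

Set Implicit Arguments.
Unset Strict Implicit.
Unset Printing Implicit Defensive.

Import Order.TTheory GRing.Theory Num.Theory.
Import numFieldNormedType.Exports.

Local Open Scope classical_set_scope.
Local Open Scope complex_scope.
Local Open Scope ring_scope.

(** Write x_k = t q1^(k/beta) and y_k = t q2^(k/delta) for the points at which
the two operators sample a function.  The condition 0 < cpow q eta says that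
q^eta is a positive real, so q^(k(eta+1)) = (q^eta q)^k is one too, and since
0 < q < 1 and mu > 0 the quotient (q^mu;q)_k / (q;q)_k is nonnegative.  Hence
F |-> I(u F) is, up to a nonnegative factor, a series with nonnegative real
coefficients a_k = w_k u(x_k) applied to the values F(x_k); convergence for
F = 1 gives absolute convergence for every F bounded on the nonnegative reals
([EK_sampling]).

With coefficients a_i, x_i for the first operator and b_j, y_j for the second,
the expression in the absolute value is, up to the two nonnegative factors, the
limit of the double sums over i, j < n of
  a_i b_j (f(x_i) - f(y_j)) (g(x_i) - g(y_j)) (h(x_i) - h(y_j)),
because expanding the triple product gives exactly the eight signed terms.  Each
difference is bounded by the length of the interval containing the values of
the function, which bounds the finite sums ([triple_difference_bound]); the
bound passes to the limit ([triple_difference_bound_lim]) and is carried back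
to the complex-valued operators. *)

(** * Complex powers of a positive real *)

Lemma cpowD (R : realType) (q : R) (a b : R[i]) : 0 < q ->
  cpow q (a + b) = cpow q a * cpow q b.
Proof.
move=> q0; case: a b => [ar ai] [br bi]; rewrite /cpow /=.
rewrite powRD; last by rewrite (gt_eqF q0) implybT.
rewrite !mulrDl cosD sinD; apply/eqP; rewrite eq_complex /=.
by apply/andP; split; apply/eqP; ring.
Qed.

Lemma cpow0 (R : realType) (q : R) : cpow q 0 = 1.
Proof. by rewrite /cpow /= mul0r cos0 sin0 powRr0 mul1r. Qed.

Lemma cpow1 (R : realType) (q : R) : 0 < q -> cpow q 1 = q%:C.
Proof.
by move=> q0; rewrite /cpow /= mul0r cos0 sin0 powRr1 ?mulr1// ltW.
Qed.

Lemma cpow_natmul (R : realType) (q : R) (z : R[i]) (k : nat) : 0 < q ->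
  cpow q (k%:R * z) = cpow q z ^+ k.
Proof.
move=> q0; elim: k => [|k IH]; first by rewrite mul0r cpow0 expr0.
by rewrite -natr1 mulrDl mul1r cpowD// IH exprSr.
Qed.

(** * Real and complex limits *)

Lemma cvgn_realC (R : realType) (a : R^nat) (l : R) :
  a @ \oo --> l -> (fun n => (a n)%:C : R[i]^o) @ \oo --> (l%:C : R[i]^o).
Proof.
move=> /cvgrPdist_lt al; apply/cvgrPdist_lt => -[e e'].
(* A positive radius in R[i] is a positive real. *)
rewrite ltcE /= => /andP[/eqP -> e0].
near=> n; rewrite -rmorphB /= normc_def /= expr0n addr0 sqrtr_sqr ltcR.
by near: n; exact: al.
Unshelve. all: by end_near.
Qed.

Lemma cvgn_Re (R : realType) (z : nat -> R[i]^o) (l : R[i]^o) :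
  z @ \oo --> l -> (fun n => complex.Re (z n)) @ \oo --> complex.Re l.
Proof.
move=> /cvgrPdist_lt zl; apply/cvgrPdist_lt => e e0.
have := zl e%:C; rewrite ltcR => /(_ e0); apply: filterS => n.
rewrite -raddfB -ltcR; apply: le_lt_trans; exact: normc_ge_Re.
Qed.

(** * Series with nonnegative coefficients and bounded functions *)

Lemma summable_mul_bounded (R : realType) (a b : R^nat) (M : R) :
  (forall k, 0 <= a k) -> (forall k, `|b k| <= M) ->
  cvgn (series a) -> cvgn (series (fun k => a k * b k)).
Proof.
move=> a0 bM ca; apply: normed_cvg.
apply: (@series_le_cvg _ _ (fun k => a k * M)) => //=.
- move=> k; apply: mulr_ge0 => //; exact: le_trans (bM k).
- by move=> k; rewrite normrM (ger0_norm (a0 k)) ler_wpM2l.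
- have -> : (fun k => a k * M) = M *: a.
    by apply/funext => k /=; rewrite mulrC.
  exact: is_cvg_seriesZ.
Qed.

(** Boundedness on the nonnegative reals, which contain every sampling point. *)
Definition bounded_nneg (R : realType) (F : R -> R) : Prop :=
  exists M, forall y, 0 <= y -> `|F y| <= M.

Lemma bounded_nneg_itv (R : realType) (F : R -> R) (m M : R) :
  (forall y, 0 <= y -> m <= F y <= M) -> bounded_nneg F.
Proof.
move=> FmM; exists (`|m| + `|M|) => y /FmM/andP[mF FM].
rewrite ler_norml; apply/andP; split.
- apply: le_trans mF; rewrite opprD; have := lerNnormlW (lexx `|m|).
  by have := normr_ge0 M; lra.
- by apply: (le_trans FM); have := ler_norm M; have := normr_ge0 m; lra.
Qed.

Lemma bounded_nneg_cst (R : realType) (c : R) : bounded_nneg (cst c).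
Proof. by exists `|c|. Qed.

Lemma bounded_nnegM (R : realType) (F G : R -> R) :
  bounded_nneg F -> bounded_nneg G -> bounded_nneg (F \* G).
Proof.
move=> [M FM] [N GN]; exists (M * N) => y y0.
by rewrite normrM ler_pM// ?FM ?GN.
Qed.

(** * The inequality for sampled sums *)

(** The products of sums on the left are the expansion of
\sum_(i < n) \sum_(j < n) a_i b_j (f x_i - f y_j) (g x_i - g y_j)
(h x_i - h y_j). *)
Lemma triple_difference_bound (R : realType) (n : nat)
    (a b x y : R^nat) (f g h : R -> R) (A B C : R) :
  (forall k, 0 <= a k) -> (forall k, 0 <= b k) ->
  (forall i j, `|f (x i) - f (y j)| <= A) ->
  (forall i j, `|g (x i) - g (y j)| <= B) ->
  (forall i j, `|h (x i) - h (y j)| <= C) ->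
  let S F := series (fun k => a k * F (x k)) n in
  let T F := series (fun k => b k * F (y k)) n in
  `| S (f \* g \* h) * T (cst 1) + S h * T (f \* g)
   + S g * T (f \* h) + S f * T (g \* h)
   - S (g \* h) * T f - S (f \* h) * T g
   - S (f \* g) * T h - S (cst 1) * T (f \* g \* h) |
  <= S (cst 1) * T (cst 1) * (A * B * C).
Proof.
move=> a0 b0 hA hB hC; rewrite /= !seriesEord /=.
pose D i j := (f (x i) - f (y j)) * (g (x i) - g (y j)) * (h (x i) - h (y j)).
set E := (X in `|X|).
have -> : E = \sum_(p : 'I_n * 'I_n) a p.1 * b p.2 * D p.1 p.2.
  rewrite /E !big_distrlr /= !pair_big /= -!big_split /= -!sumrB.
  by apply: eq_bigr => p _; rewrite /D; ring.
rewrite big_distrlr /= pair_big /= mulr_suml.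
apply: le_trans (ler_norm_sum _ _ _) _; apply: ler_sum => p _.
rewrite !mulr1 normrM ger0_norm ?mulr_ge0//.
apply: ler_wpM2l; first exact: mulr_ge0.
by rewrite !normrM; apply: ler_pM => //; rewrite ?mulr_ge0// ler_pM.
Qed.

Lemma triple_difference_bound_lim (R : realType)
    (a b x y : R^nat) (f g h : R -> R) (A B C : R) :
  (forall k, 0 <= a k) -> (forall k, 0 <= b k) ->
  (forall k, 0 <= x k) -> (forall k, 0 <= y k) ->
  cvgn (series a) -> cvgn (series b) ->
  bounded_nneg f -> bounded_nneg g -> bounded_nneg h ->
  (forall i j, `|f (x i) - f (y j)| <= A) ->
  (forall i j, `|g (x i) - g (y j)| <= B) ->
  (forall i j, `|h (x i) - h (y j)| <= C) ->
  let S F := limn (series (fun k => a k * F (x k))) in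
  let T F := limn (series (fun k => b k * F (y k))) in
  `| S (f \* g \* h) * T (cst 1) + S h * T (f \* g)
   + S g * T (f \* h) + S f * T (g \* h)
   - S (g \* h) * T f - S (f \* h) * T g
   - S (f \* g) * T h - S (cst 1) * T (f \* g \* h) |
  <= S (cst 1) * T (cst 1) * (A * B * C).
Proof.
move=> a0 b0 x0 y0 ca cb bf bg bh hA hB hC /=.
have cS F : bounded_nneg F -> cvgn (series (fun k => a k * F (x k))).
  by case=> M FM; apply: summable_mul_bounded ca => // k; exact: FM.
have cT F : bounded_nneg F -> cvgn (series (fun k => b k * F (y k))).
  by case=> M FM; apply: summable_mul_bounded cb => // k; exact: FM.
have b1 := bounded_nneg_cst (1 : R).
have bfg := bounded_nnegM bf bg.
have bfh := bounded_nnegM bf bh.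
have bgh := bounded_nnegM bg bh.
have bfgh := bounded_nnegM bfg bh.
have cST F G : bounded_nneg F -> bounded_nneg G ->
    series (fun k => a k * F (x k)) n * series (fun k => b k * G (y k)) n
    @[n --> \oo] -->
    limn (series (fun k => a k * F (x k))) *
    limn (series (fun k => b k * G (y k))).
  by move=> bF bG; apply: cvgM; [exact: cS | exact: cT].
apply: (@ler_cvg_to _ \oo); last first.
- by apply: nearW => n; exact: (triple_difference_bound n a0 b0 hA hB hC).
- by apply: cvgM; [exact: cST | exact: cvg_cst].
- apply: cvg_norm; do 4![apply: cvgB; last exact: cST].
  by do 3![apply: cvgD; last exact: cST]; exact: cST.
Qed.

(** * The q-integral operator as a nonnegative real series *)

(** The real coefficient of F (t q^(k/beta)) in the series of the operator when
q^eta is a positive real: q^(k(eta+1)) is then the k-th power of the real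
number q^eta q, and taking the real part of q^eta only changes its type. *)
Definition EK_weight (R : realType) (q : R) (eta : R[i]) (mu : R) (k : nat) :
    R :=
  qpochhammer (q `^ mu) q k / qpochhammer q q k
  * (complex.Re (cpow q eta) * q) ^+ k.

Lemma qpochhammer_ge0 (R : realType) (a q : R) (k : nat) :
  0 <= a <= 1 -> 0 <= q <= 1 -> 0 <= qpochhammer a q k.
Proof.
move=> /andP[a0 a1] /andP[q0 q1]; apply: prodr_ge0 => j _.
by rewrite subr_ge0 mulr_ile1 ?exprn_ge0 ?exprn_ile1.
Qed.

Lemma EK_weight_ge0 (R : realType) (q : R) (eta : R[i]) (mu : R) (k : nat) :
  0 < q < 1 -> 0 < mu -> 0 < cpow q eta -> 0 <= EK_weight q eta mu k.
Proof.
move=> /andP[q0 q1] mu0; rewrite ltcE => /andP[_ /ltW r0].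
have q01 : 0 <= q <= 1 by rewrite !ltW.
rewrite /EK_weight mulr_ge0//; last by rewrite exprn_ge0// mulr_ge0// ltW.
rewrite divr_ge0 ?qpochhammer_ge0//= powR_ge0/=.
by rewrite -[leRHS](powRr0 q) ger_powR ?q0// ltW.
Qed.

Lemma EK_termE (R : realType) (q : R) (eta : R[i]) (mu beta : R)
    (F : R -> R) (t : R) (k : nat) :
  0 < q -> 0 < cpow q eta ->
  EK_term q eta mu beta F t k =
  (EK_weight q eta mu k * F (t * q `^ (k%:R / beta)))%:C.
Proof.
move=> q0 r0; rewrite /EK_term /EK_weight !rmorphM; congr (_ * _ * _).
rewrite cpow_natmul// cpowD// cpow1// rmorphXn rmorphM.
by congr ((_ * _) ^+ _); rewrite -[LHS]RRe_real// gtr0_real.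
Qed.

Lemma series_realC (R : realType) (a : R^nat) :
  series (fun k => (a k)%:C : R[i]^o) = (fun n => (series a n)%:C).
Proof. by apply/funext => n; rewrite /series /= rmorph_sum. Qed.

(** Weighting by a nonnegative u for which the series converges turns the
operator into a functional F |-> c \sum_k a_k F(x_k) on bounded functions, with
c, a_k, x_k nonnegative and \sum_k a_k convergent.  The witnesses are the
constant factor of the operator, a_k = EK_weight k * u (x_k) and
x_k = t q^(k/beta).  The function u F is passed as any G equal to it pointwise,
so that the products may be associated in any way. *)
Lemma EK_sampling (R : realType) (q : R) (eta : R[i]) (mu beta : R)
    (u : R -> R) (t : R) :
  0 < q < 1 -> 0 < mu -> 0 < beta -> 0 < t -> 0 < cpow q eta ->
  (forall x, 0 <= x -> 0 <= u x) -> EK_cvg q eta mu beta u t ->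
  exists (c : R) (a x : R^nat),
    [/\ 0 <= c, forall k, 0 <= a k, forall k, 0 <= x k, cvgn (series a) &
    forall F G : R -> R, bounded_nneg F ->
      (forall y, G y = u y * F y) ->
      EK q eta mu beta G t =
      (c * limn (series (fun k => a k * F (x k))))%:C].
Proof.
move=> q01 mu0 beta0 t0 r0 u0; have /andP[q0 q1] := q01.
pose w := EK_weight q eta mu.
pose x k := t * q `^ (k%:R / beta).
have x0 k : 0 <= x k by rewrite mulr_ge0 ?powR_ge0// ltW.
have termE F : EK_term q eta mu beta F t = fun k => (w k * F (x k))%:C.
  by apply/funext => k; exact: EK_termE.
have a0 k : 0 <= w k * u (x k) by rewrite mulr_ge0 ?u0//; exact: EK_weight_ge0.
rewrite /EK_cvg termE series_realC => cu.
have ca : cvgn (series (fun k => w k * u (x k))).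
  by apply/cvg_ex; case/cvg_ex: cu => l /cvgn_Re; exists (complex.Re l).
exists (beta * (1 - q `^ beta^-1) * (1 - q) `^ (mu - 1)).
exists (fun k => w k * u (x k)), x; split => //.
  rewrite mulr_ge0 ?powR_ge0// mulr_ge0 ?(ltW beta0)// subr_ge0.
  by rewrite -[leRHS](powRr0 q) ger_powR ?q0 ?ltW// invr_gt0.
move=> F G [M FM] GuF; rewrite /EK termE [RHS]rmorphM; congr (_ * _).
have -> : (fun k => (w k * G (x k))%:C) =
    (fun k => (w k * u (x k) * F (x k))%:C).
  by apply/funext => k; rewrite GuF mulrA.
rewrite series_realC; apply: (@cvg_lim (R[i]^o : ptopologicalType)).
  exact: norm_hausdorff.
apply: cvgn_realC; apply: (summable_mul_bounded a0 _ ca) => k; exact: FM.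
Qed.

(** * The inequality for the q-integral operators *)

Theorem theorem3 (R : realType) (q1 q2 : R)
    (hq1 : 0 < q1 < 1) (hq2 : 0 < q2 < 1)
    (u : R -> R)
    (u_ge0 : forall x, 0 <= x -> 0 <= u x)
    (u_cont : {within `[0, +oo[, continuous u})
    (lambda : R) (f g h : R -> R)
    (hf : class_C lambda f) (hg : class_C lambda g) (hh : class_C lambda h)
    (hsync : synchronous3 `[0, +oo[ f g h)
    (phi psi omega Phi Psi Omega : R)
    (f_bnd : forall x, 0 <= x -> psi <= f x <= Psi)
    (g_bnd : forall x, 0 <= x -> phi <= g x <= Phi)
    (h_bnd : forall x, 0 <= x -> omega <= h x <= Omega)
    (t mu nu beta delta : R)
    (t_gt0 : 0 < t) (mu_gt0 : 0 < mu) (nu_gt0 : 0 < nu)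
    (beta_gt0 : 0 < beta) (delta_gt0 : 0 < delta)
    (eta zeta : R[i])
    (heta : 0 < cpow q1 eta) (hzeta : 0 < cpow q2 zeta)
    (cvg1 : EK_cvg q1 eta mu beta u t) (cvg2 : EK_cvg q2 zeta nu delta u t) :
  let I1 F := EK q1 eta mu beta F t in
  let I2 F := EK q2 zeta nu delta F t in
  `| I1 (u \* f \* g \* h) * I2 u + I1 (u \* h) * I2 (u \* f \* g)
   + I1 (u \* g) * I2 (u \* f \* h) + I1 (u \* f) * I2 (u \* g \* h)
   - I1 (u \* g \* h) * I2 (u \* f) - I1 (u \* f \* h) * I2 (u \* g)
   - I1 (u \* f \* g) * I2 (u \* h) - I1 u * I2 (u \* f \* g \* h) |
  <= I1 u * I2 u * ((Psi - psi) * (Phi - phi) * (Omega - omega))%:C.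
Proof.
have [c [a [x [c0 a0 x0 ca EK1]]]] :=
  EK_sampling hq1 mu_gt0 beta_gt0 t_gt0 heta u_ge0 cvg1.
have [d [b [y [d0 b0 y0 cb EK2]]]] :=
  EK_sampling hq2 nu_gt0 delta_gt0 t_gt0 hzeta u_ge0 cvg2.
have osc (F : R -> R) m M : (forall s, 0 <= s -> m <= F s <= M) ->
    forall i j, `|F (x i) - F (y j)| <= M - m.
  move=> FmM i j; have /andP[? ?] := FmM _ (x0 i).
  have /andP[? ?] := FmM _ (y0 j).
  by rewrite ler_norml; apply/andP; split; lra.
have bf := bounded_nneg_itv f_bnd.
have bg := bounded_nneg_itv g_bnd.
have bh := bounded_nneg_itv h_bnd.
have b1 := bounded_nneg_cst (1 : R).
have bfg := bounded_nnegM bf bg.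
have bfh := bounded_nnegM bf bh.
have bgh := bounded_nnegM bg bh.
have bfgh := bounded_nnegM bfg bh.
have main := triple_difference_bound_lim a0 b0 x0 y0 ca cb bf bg bh
  (osc _ _ _ f_bnd) (osc _ _ _ g_bnd) (osc _ _ _ h_bnd).
cbv zeta in main |- *.
have u1 s : u s = u s * cst 1 s by rewrite mulr1.
have uM (F : R -> R) s : (u \* F) s = u s * F s by [].
have uMM (F G : R -> R) s : (u \* F \* G) s = u s * (F \* G) s.
  by rewrite /= mulrA.
have uMMM (F G H : R -> R) s : (u \* F \* G \* H) s = u s * (F \* G \* H) s.
  by rewrite /= !mulrA.
rewrite !(EK1 _ _ b1 u1, EK2 _ _ b1 u1, EK1 _ _ bfgh (uMMM _ _ _),
  EK2 _ _ bfgh (uMMM _ _ _), EK1 _ _ bfg (uMM _ _), EK2 _ _ bfg (uMM _ _),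
  EK1 _ _ bfh (uMM _ _), EK2 _ _ bfh (uMM _ _),
  EK1 _ _ bgh (uMM _ _), EK2 _ _ bgh (uMM _ _),
  EK1 _ _ bf (uM _), EK2 _ _ bf (uM _), EK1 _ _ bg (uM _),
  EK2 _ _ bg (uM _), EK1 _ _ bh (uM _), EK2 _ _ bh (uM _)).
(* All the values of the operators are real, so the claim is one about reals. *)
rewrite -!(rmorphM, rmorphD, rmorphB) /= normc_def /= expr0n addr0 sqrtr_sqr.
rewrite lecR.
set E := (X in `|X| <= _) in main.
set E' := (X in `|X| <= _).
have -> : E' = c * d * E by rewrite /E /E'; ring.
rewrite normrM (ger0_norm (mulr_ge0 c0 d0)).
apply: (le_trans (ler_wpM2l (mulr_ge0 c0 d0) main)).
by rewrite le_eqVlt; apply/orP; left; apply/eqP; ring.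
Qed.
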